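(* Any derivation in Extended Polynomial Calculus over $\mathbb{Q}$ with the square root rule of (the translation of) an unsatisfiable CNF from $\mathsf{eBVP}_n$ requires size $\Omega(2^{n/3})$.
   Context: $\mathsf{eBVP}_n$ is the equation $M + x_1 + 2x_2 + \ldots + 2^{n-1}x_n = 0$ for an integer $M>0$, together with the Boolean axioms $x_i^2 - x_i = 0$. Extended Polynomial Calculus over $\mathbb{Q}$ derives polynomials (read as equations $=0$) by rational linear combinations and multiplication by variables, allows extension axioms $y_j - q_j(\bar x, y_1,\ldots,y_{j-1})$ introducing new variables, and the square root rule derives $r$ from $r^2$. Size is the total bit size of the rational coefficients. Deriving an unsatisfiable CNF means deriving, for each clause, the equation $y_{j_1}\cdots y_{j_k}\cdot \neg y_{\ell_1}\cdots\neg y_{\ell_r}=0$, where the $y$'s may be extension variables, $\neg y_\ell$ is an extension variable defined by $\neg y_\ell = 1-y_\ell$, and also deriving $y_i^2-y_i=0$ for every variable $y_i$ occurring in the CNF. *)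

(* Defs.v *)
From HB Require Import structures.
From mathcomp Require Import all_boot all_order all_algebra.
From mathcomp Require Import mpoly.

Set Implicit Arguments.
Unset Strict Implicit.
Unset Printing Implicit Defensive.

Import Order.TTheory GRing.Theory Num.Theory.
Local Open Scope ring_scope.

(* Polynomials in [n + k] variables: the original variables x_1, ..., x_n have
   indices [lshift k i], the extension variables y_1, ..., y_k have indices
   [rshift n j], both numbered from 0. *)
Notation extpoly n k := {mpoly rat[n + k]}.

(* The summand with index i : 'I_n is 2^i x_{i+1}. *)
Definition eBVP_eq (n k : nat) (M : int) : extpoly n k :=
  M%:~R + \sum_(i < n) 2 ^+ i *: 'X_(lshift k i).

Definition eBVP (n k : nat) (M : int) (p : extpoly n k) : Prop :=
  p = eBVP_eq n k M \/
  exists i : 'I_n, p = 'X_(lshift k i) ^+ 2 - 'X_(lshift k i).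

Section ExtPC.

Variables n k : nat.
Implicit Types (p r : extpoly n k) (q : 'I_k -> extpoly n k).

(* [q j] is the polynomial defining y_j; it mentions only the x's and
   y_1, ..., y_(j-1). *)
Definition extension_system q : Prop :=
  forall (j : 'I_k) (m : 'X_{1..n + k}), m \in msupp (q j) ->
  forall i : 'I_(n + k), (n + j <= i)%N -> m i = 0%N.

Definition extension_axiom q p : Prop :=
  exists j : 'I_k, p = 'X_(rshift n j) - q j.

Definition inference (Gamma : extpoly n k -> Prop) q
    (prev : seq (extpoly n k)) r : Prop :=
  [\/ Gamma r \/ extension_axiom q r,
      exists a b : rat, exists p1 p2,
        [/\ p1 \in prev, p2 \in prev & r = a *: p1 + b *: p2],
      exists (i : 'I_(n + k)) p, p \in prev /\ r = 'X_i * p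
    | r ^+ 2 \in prev].

Definition derivation Gamma q (pi : seq (extpoly n k)) : Prop :=
  extension_system q /\
  forall i, (i < size pi)%N -> inference Gamma q (take i pi) pi`_i.

End ExtPC.

Definition nat_bits (a : nat) : nat := (trunc_log 2 a).+1.

Definition rat_bits (a : rat) : nat :=
  (nat_bits `|numq a| + nat_bits `|denq a|)%N.

(* [msupp p] lists the monomials of [p] with a nonzero coefficient. *)
Definition poly_bits (m : nat) (p : {mpoly rat[m]}) : nat :=
  (\sum_(u <- msupp p) rat_bits p@_u)%N.

(* Only the lines are charged: neither the scalars [a], [b] of the linear
   combinations nor the extension axioms that do not occur as lines. *)
Definition derivation_size (m : nat) (pi : seq {mpoly rat[m]}) : nat :=
  (\sum_(p <- pi) poly_bits p)%N.

(* [(v, true)] is the literal v, [(v, false)] is its negation. *)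
Definition literal (m : nat) := ('I_m * bool)%type.
Definition clause (m : nat) := seq (literal m).
Definition cnf (m : nat) := seq (clause m).

Definition cnf_sat (m : nat) (v : 'I_m -> bool) (F : cnf m) : bool :=
  all (has (fun l : literal m => v l.1 == l.2)) F.

Definition unsatisfiable (m : nat) (F : cnf m) : Prop :=
  forall v : 'I_m -> bool, ~~ cnf_sat v F.

Definition occurs (m : nat) (v : 'I_m) (F : cnf m) : Prop :=
  exists2 C : clause m, C \in F & exists b : bool, (v, b) \in C.

Section Translation.

Variables n k : nat.

(* A negative literal contributes its variable v, a positive literal the
   variable [neg v] standing for 1 - v: at a Boolean point the product is 1 if
   the clause is falsified and 0 if it is satisfied. *)
Definition clause_poly (neg : 'I_(n + k) -> 'I_(n + k)) (C : clause (n + k)) :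
    extpoly n k :=
  \prod_(l <- C) 'X_(if l.2 then neg l.1 else l.1).

Definition negation_var (q : 'I_k -> extpoly n k) (v w : 'I_(n + k)) : Prop :=
  exists2 j : 'I_k, w = rshift n j & q j = 1 - 'X_v.

(* [neg v] is constrained only for the variables v that occur positively in
   [F], the ones whose negation occurs in the translation. *)
Definition derives_cnf (q : 'I_k -> extpoly n k) (pi : seq (extpoly n k))
    (F : cnf (n + k)) : Prop :=
  (exists2 neg : 'I_(n + k) -> 'I_(n + k),
     (forall C v, C \in F -> (v, true) \in C -> negation_var q v (neg v)) &
     (forall C, C \in F -> clause_poly neg C \in pi)) /\
  (forall v, occurs v F -> 'X_v ^+ 2 - 'X_v \in pi).

End Translation.

(* Main.v *)
(* Let s be the size of the derivation. Call a prime p <= 2^n bad if it divides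
   a numerator or denominator of a coefficient of a line, or the numerator of a
   chosen nonzero 2x2 minor of the coefficients of a pair of lines. There are
   O(s^2) bad primes. If p is not bad, choose Boolean x's with
   M + sum 2^i x_i = 0 mod p and let the y's follow their definitions: every line
   then evaluates into the maximal ideal of Z localized at p. The square root
   rule respects this ideal because it is prime, and the linear combinations
   because of the minors. Hence the variables of the CNF are Boolean mod p and
   satisfy it, which is impossible. So all the primes up to 2^n are bad, and there
   are at least 2^(n-1) / n of them by the prime factorization of the central
   binomial coefficient. Therefore 2^n <= 12 n s^2, and n <= 2^(n/3). *)
Require Import Defs.
From mathcomp Require Import all_boot all_order all_algebra.
From mathcomp Require Import boolp reals exp.
From mathcomp Require Import mpoly zify ring lra.

Set Implicit Arguments.
Unset Strict Implicit.
Unset Printing Implicit Defensive.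

Import Order.TTheory GRing.Theory Num.Theory.

(** * Counting primes with the central binomial coefficient *)

(** Pascal's rule and symmetry give C(2m+2, m+1) = 2 C(2m+1, m), so each induction step at least
    doubles the coefficient. *)
Lemma exp2_le_central_bin m : 2 ^ m <= 'C(m.*2, m).
Proof.
elim: m => [|m IHm]; first by rewrite bin0.
have le_bin : 'C(m.*2, m) <= 'C(m.*2.+1, m) by apply: leq_bin2l.
have e4 : 'C(m.+1.*2, m.+1) = 2 * 'C(m.*2.+1, m).
  rewrite doubleS binS -{1}(bin_sub (n := m.*2.+1)) ?mul2n -?addnn; last by lia.
  by rewrite (_ : (m + m).+1 - m.+1 = m) //; lia.
rewrite e4 expnS leq_mul2l /= (leq_trans IHm) //.
Qed.

(** By Legendre's formula the exponent of p is the sum over k of floor(2m/p^k) - 2 floor(m/p^k).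
    Each term is at most 1 and vanishes once p^k > 2m. *)
Lemma pfactor_central_bin_le p m :
  prime p -> 0 < m -> p ^ logn p 'C(m.*2, m) <= m.*2.
Proof.
move=> p_pr m_gt0; have p_gt1 := prime_gt1 p_pr.
have m2_gt0 : 0 < m.*2 by rewrite double_gt0.
have le_m2 : m <= m.*2 by rewrite -addnn leq_addr.
suff le_t : logn p 'C(m.*2, m) <= trunc_log p m.*2.
  by rewrite (leq_trans (leq_pexp2l _ le_t)) ?prime_gt0 // trunc_logP.
have := congr1 (logn p) (bin_fact le_m2).
rewrite -{2}addnn addnK !lognM ?muln_gt0 ?fact_gt0 ?bin_gt0 //.
rewrite !logn_fact // => eq_logn.
(* The Legendre sum of m! is padded with zero terms to the range used for (2m)!. *)
have ext : \sum_(1 <= k < m.+1) m %/ p ^ k = \sum_(1 <= k < m.*2.+1) m %/ p ^ k.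
  rewrite [RHS](@big_cat_nat _ _ _ m.+1) //= [X in _ = _ + X]big_nat_cond.
  rewrite [X in _ = _ + X]big1 ?addn0 // => k /andP[/andP[lt_mk _] _].
  by rewrite divn_small // (leq_trans lt_mk) // ltnW // ltn_expl.
have le1 : \sum_(1 <= k < m.*2.+1) m.*2 %/ p ^ k <=
    \sum_(1 <= k < m.*2.+1) (2 * (m %/ p ^ k) + (k <= trunc_log p m.*2)).
  rewrite big_nat_cond [leqRHS]big_nat_cond; apply: leq_sum => k _.
  have pk_gt0 : 0 < p ^ k by rewrite expn_gt0 ltnW.
  case: (leqP k (trunc_log p m.*2)) => [_|lt_tk].
    rewrite -ltnS ltn_divLR //.
    have := divn_eq m (p ^ k); have := ltn_pmod m pk_gt0; nia.
  by rewrite divn_small // (leq_trans (trunc_log_ltn _ p_gt1)) //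
    leq_pexp2l // ltnW.
have le2 : \sum_(1 <= k < m.*2.+1) (k <= trunc_log p m.*2) <= trunc_log p m.*2.
  have -> : \sum_(1 <= k < m.*2.+1) (k <= trunc_log p m.*2)
     = count (fun k => k <= trunc_log p m.*2) (index_iota 1 m.*2.+1).
    by rewrite -sum1_count [RHS]big_mkcond; apply: eq_bigr => k _; case: leqP.
  rewrite -size_filter -{2}(size_iota 1 (trunc_log p m.*2)).
  apply: uniq_leq_size; first by rewrite filter_uniq ?iota_uniq.
  by move=> k; rewrite mem_filter mem_index_iota mem_iota; lia.
by move: le1; rewrite big_split /= -big_distrr /=; lia.
Qed.

Definition primes_upto N := [seq p <- iota 0 N.+1 | prime p].

Lemma primes_upto_uniq N : uniq (primes_upto N).
Proof. by rewrite filter_uniq ?iota_uniq. Qed.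

Lemma mem_primes_upto N p : (p \in primes_upto N) = prime p && (p <= N).
Proof. by rewrite mem_filter mem_iota. Qed.

Lemma leq_prod_const (T : eqType) (s : seq T) (f : T -> nat) c :
  {in s, forall x, f x <= c} -> \prod_(x <- s) f x <= c ^ size s.
Proof.
elim: s => [|x s IHs] f_le; first by rewrite big_nil.
rewrite big_cons expnS leq_mul ?f_le ?mem_head // IHs // => y ys.
by rewrite f_le // inE ys orbT.
Qed.

Lemma const_leq_prod (T : eqType) (s : seq T) (f : T -> nat) c :
  {in s, forall x, c <= f x} -> c ^ size s <= \prod_(x <- s) f x.
Proof.
elim: s => [|x s IHs] f_ge; first by rewrite big_nil.
rewrite big_cons expnS leq_mul ?f_ge ?mem_head // IHs // => y ys.
by rewrite f_ge // inE ys orbT.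
Qed.

(** The central binomial coefficient is a product of prime powers at most 2m, one for each prime
    divisor, and these primes are themselves at most 2m. *)
Lemma exp2_le_primes_upto m :
  0 < m -> 2 ^ m <= m.*2 ^ size (primes_upto m.*2).
Proof.
move=> m_gt0; set B := 'C(m.*2, m).
have B_gt0 : 0 < B by rewrite bin_gt0 -addnn leq_addr.
apply: leq_trans (exp2_le_central_bin m) _.
have le_size : size (primes B) <= size (primes_upto m.*2).
  apply: uniq_leq_size (primes_uniq _) _ => p p_B; rewrite mem_primes_upto.
  move: (p_B); rewrite mem_primes => /and3P[p_pr _ _]; rewrite p_pr /=.
  apply: leq_trans (pfactor_central_bin_le p_pr m_gt0).
  by rewrite -{1}(expn1 p) leq_exp2l ?prime_gt1 // logn_gt0.
apply: leq_trans (leq_pexp2l _ le_size); last by rewrite double_gt0.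
rewrite [leqLHS](prod_prime_decomp B_gt0) prime_decompE big_map /=.
apply: leq_prod_const => p; rewrite mem_primes => /and3P[p_pr _ _].
exact: pfactor_central_bin_le.
Qed.

Lemma exp2_size_primes_le a : 0 < a -> 2 ^ size (primes a) <= a.
Proof.
move=> a_gt0; rewrite [leqRHS](prod_prime_decomp a_gt0) prime_decompE big_map /=.
apply: const_leq_prod => p pP; move: (pP); rewrite mem_primes => /and3P[p_pr _ _].
rewrite (leq_trans (prime_gt1 p_pr)) // -{1}(expn1 p).
by rewrite leq_exp2l ?prime_gt1 // logn_gt0.
Qed.

(** With 2m = 2^n, [exp2_le_primes_upto] becomes a comparison of exponents of 2. *)
Lemma primes_upto_exp2 n : 0 < n -> 2 ^ n.-1 <= n * size (primes_upto (2 ^ n)).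
Proof.
case: n => [//|n] _ /=; have := @exp2_le_primes_upto (2 ^ n).
by rewrite expn_gt0 -mul2n -expnS -expnM leq_exp2l //; exact.
Qed.

Local Open Scope ring_scope.

(** * The localization of the integers at a prime *)

(** The fraction a/b need not be reduced, so sums and products require no normalization. *)
Definition padic_int (p : nat) (x : rat) : Prop :=
  exists a b : int, ~~ (p %| b)%Z /\ x * b%:~R = a%:~R.

(* The maximal ideal of the ring of p-integral rationals. *)
Definition padic_max (p : nat) (x : rat) : Prop :=
  exists a b : int, [/\ ~~ (p %| b)%Z, (p %| a)%Z & x * b%:~R = a%:~R].

Lemma Euclid_dvdzM (p : nat) (a b : int) :
  prime p -> (p %| a * b)%Z = (p %| a)%Z || (p %| b)%Z.
Proof. by move=> p_pr; rewrite !dvdzE abszM Euclid_dvdM. Qed.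

Lemma ndvdzM (p : nat) (a b : int) :
  prime p -> ~~ (p %| a)%Z -> ~~ (p %| b)%Z -> ~~ (p %| a * b)%Z.
Proof. by move=> p_pr na nb; rewrite Euclid_dvdzM // negb_or na. Qed.

Lemma padic_int_intr (p : nat) (a : int) : prime p -> padic_int p a%:~R.
Proof.
move=> p_pr; exists a, 1; rewrite mulr1; split=> //.
by rewrite dvdzE /= dvdn1 neq_ltn prime_gt1 // orbT.
Qed.

Lemma padic_max_intr (p : nat) (a : int) :
  prime p -> (p %| a)%Z -> padic_max p a%:~R.
Proof.
move=> p_pr pa; exists a, 1; rewrite mulr1; split=> //.
by rewrite dvdzE /= dvdn1 neq_ltn prime_gt1 // orbT.
Qed.

Lemma padic_int_denq (p : nat) x : ~~ (p %| `|denq x|)%N -> padic_int p x.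
Proof.
by move=> npd; exists (numq x), (denq x); rewrite dvdzE; split=> //; rewrite -numqE.
Qed.

Lemma padic_int_invq (p : nat) x :
  x != 0 -> ~~ (p %| `|numq x|)%N -> padic_int p x^-1.
Proof.
move=> x0 npn; exists (denq x), (numq x); rewrite dvdzE; split=> //.
by rewrite numqE mulKf.
Qed.

Lemma padic_intD p x y :
  prime p -> padic_int p x -> padic_int p y -> padic_int p (x + y).
Proof.
move=> p_pr [a [b [nb ex]]] [c [d [nd ey]]]; exists (a * d + c * b), (b * d).
split; first exact: ndvdzM.
by rewrite rmorphD !rmorphM /= -ex -ey; ring.
Qed.

Lemma padic_intM p x y :
  prime p -> padic_int p x -> padic_int p y -> padic_int p (x * y).
Proof.
move=> p_pr [a [b [nb ex]]] [c [d [nd ey]]]; exists (a * c), (b * d).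
by split; [exact: ndvdzM|rewrite !rmorphM /= -ex -ey; ring].
Qed.

Lemma padic_intN p x : padic_int p x -> padic_int p (- x).
Proof. by case=> a [b [nb ex]]; exists (- a), b; rewrite mulNr ex rmorphN. Qed.

Lemma padic_intX p x k : prime p -> padic_int p x -> padic_int p (x ^+ k).
Proof.
move=> p_pr xp; elim: k => [|k IHk]; first exact: (padic_int_intr 1).
by rewrite exprS; apply: padic_intM.
Qed.

Lemma padic_maxD p x y :
  prime p -> padic_max p x -> padic_max p y -> padic_max p (x + y).
Proof.
move=> p_pr [a [b [nb pa ex]]] [c [d [nd pc ey]]]; exists (a * d + c * b), (b * d).
split; [exact: ndvdzM|by apply: rpredD; apply: dvdz_mulr|].
by rewrite rmorphD !rmorphM /= -ex -ey; ring.
Qed.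

Lemma padic_maxMl p x y :
  prime p -> padic_int p x -> padic_max p y -> padic_max p (x * y).
Proof.
move=> p_pr [a [b [nb ex]]] [c [d [nd pc ey]]]; exists (a * c), (b * d).
by split; [exact: ndvdzM|rewrite dvdz_mull|rewrite !rmorphM /= -ex -ey; ring].
Qed.

(** Write x = a/b, y = c/d, xy = e/f. Then p divides a c f = e b d but not f, hence it divides a or
    c. *)
Lemma padic_maxM p x y : prime p -> padic_int p x -> padic_int p y ->
  padic_max p (x * y) -> padic_max p x \/ padic_max p y.
Proof.
move=> p_pr [a [b [nb ex]]] [c [d [nd ey]]] [e [f [nf pe exy]]].
have : (p %| a * c * f)%Z.
  suff -> : a * c * f = e * (b * d) by rewrite dvdz_mulr.
  apply: (intr_inj (R := rat)); rewrite !rmorphM /= -ex -ey -exy; ring.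
rewrite !Euclid_dvdzM // (negbTE nf) orbF => /orP[pa|pc]; [left|right].
  by exists a, b.
by exists c, d.
Qed.

Lemma padic_max1 p : prime p -> ~ padic_max p 1.
Proof.
move=> p_pr [a [b [nb pa]]]; rewrite mul1r => /intr_inj eba.
by rewrite eba pa in nb.
Qed.

(** * The bad primes of a derivation *)

Lemma ltn_exp2_nat_bits a : (a < 2 ^ nat_bits a)%N.
Proof. exact: trunc_log_ltn. Qed.

Lemma size_primes_nat_bits a : (size (primes a) <= nat_bits a)%N.
Proof.
case: (posnP a) => [->|a_gt0] //; rewrite -(leq_exp2l (m := 2)) //.
exact: leq_trans (exp2_size_primes_le a_gt0) (ltnW (ltn_exp2_nat_bits a)).
Qed.

(** Over a common denominator the numerator is a difference of two integers, each at most 2 to the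
    total number of bits. The extra 1 pays for the two terms. *)
Lemma size_primes_minor (x y z w : rat) : x * y - z * w != 0 ->
  (size (primes `|numq (x * y - z * w)%R|) <=
    (rat_bits x + rat_bits y + rat_bits z + rat_bits w).+1)%N.
Proof.
set D := _ - _ => D0.
pose N := numq x * numq y * denq z * denq w - numq z * numq w * denq x * denq y.
have eN : numq D * (denq x * denq y * denq z * denq w) = N * denq D.
  apply: (intr_inj (R := rat)); rewrite /N !(rmorphB, rmorphM) /= !numqE /D; ring.
have N0 : N != 0.
  apply: contraNneq D0 => N0; move/eqP: eN.
  by rewrite N0 mul0r !mulf_eq0 !denq_eq0 !orbF numq_eq0.
have le_N : (`|numq D| <= `|N|)%N.
  (* [numq D] divides [N * denq D] and is coprime to [denq D], hence it divides [N]. *)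
  rewrite dvdn_leq ?absz_gt0 // -(@Gauss_dvdl _ `|N| `|denq D|) ?coprime_num_den //.
  by rewrite -abszM -eN abszM dvdn_mulr.
rewrite -(leq_exp2l (m := 2)) //.
have numD_gt0 : (0 < `|numq D|)%N by rewrite absz_gt0 numq_eq0.
apply: leq_trans (exp2_size_primes_le numD_gt0) (leq_trans le_N _).
have le_abs : (`|N| <= `|numq x| * `|numq y| * `|denq z| * `|denq w| +
    `|numq z| * `|numq w| * `|denq x| * `|denq y|)%N by rewrite -!abszM /N; lia.
apply: leq_trans le_abs _; rewrite expnS mul2n -addnn /rat_bits !expnD.
have lt_bits a := ltnW (ltn_exp2_nat_bits a).
apply: leq_add; [set r := (X in (_ <= X)%N)|set r := (X in (_ <= X)%N)].
  (* Four of the eight powers of 2 bound the product; the other four are at least 1. *)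
  have -> : r = (2 ^ nat_bits `|numq x| * 2 ^ nat_bits `|numq y|
      * 2 ^ nat_bits `|denq z| * 2 ^ nat_bits `|denq w| *
      (2 ^ nat_bits `|denq x| * 2 ^ nat_bits `|denq y|
      * 2 ^ nat_bits `|numq z| * 2 ^ nat_bits `|numq w|))%N by rewrite /r; ring.
  apply: leq_trans (leq_pmulr _ _); last by rewrite !muln_gt0 !expn_gt0.
  by rewrite !leq_mul.
have -> : r = (2 ^ nat_bits `|numq z| * 2 ^ nat_bits `|numq w|
      * 2 ^ nat_bits `|denq x| * 2 ^ nat_bits `|denq y| *
      (2 ^ nat_bits `|denq z| * 2 ^ nat_bits `|denq w|
      * 2 ^ nat_bits `|numq x| * 2 ^ nat_bits `|numq y|))%N by rewrite /r; ring.
apply: leq_trans (leq_pmulr _ _); last by rewrite !muln_gt0 !expn_gt0.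
by rewrite !leq_mul.
Qed.

Section BadPrimes.

Variable m : nat.
Implicit Types (f g : {mpoly rat[m]}) (pi : seq {mpoly rat[m]}).

(** Exponents in the supports suffice to detect independence, by [minors0_proportional]. *)
Definition minors f g : seq rat :=
  [seq f@_u * g@_v - f@_v * g@_u | u <- msupp f, v <- msupp g].

(** One nonzero minor is enough for Cramer's rule. The default 1 has no prime divisors, so a
    proportional pair adds no bad prime. *)
Definition minor f g : rat := head 1 [seq d <- minors f g | d != 0].

Definition coef_primes f : seq nat :=
  flatten [seq primes `|numq f@_u| ++ primes `|denq f@_u| | u <- msupp f].

(** Zero lines have size 0, so the size does not bound their number; they are filtered out. *)
Definition bad_primes pi : seq nat :=
  flatten [seq coef_primes f | f <- pi & f != 0] ++
  flatten [seq flatten [seq primes `|numq (minor f g)| | g <- pi & g != 0]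
          | f <- pi & f != 0].

Lemma size_coef_primes f : (size (coef_primes f) <= poly_bits f)%N.
Proof.
rewrite /poly_bits size_flatten sumnE !big_map; apply: leq_sum => u _.
by rewrite size_cat leq_add ?size_primes_nat_bits.
Qed.

Lemma msupp_inhabited f : f != 0 -> exists u, u \in msupp f.
Proof.
rewrite -msupp_eq0; case: (msupp f) => // u s _.
by exists u; apply: mem_head.
Qed.

Lemma poly_bits_gt1 f : f != 0 -> (1 < poly_bits f)%N.
Proof.
rewrite -msupp_eq0 /poly_bits; case: (msupp f) => // u s _.
by rewrite big_cons /rat_bits /nat_bits addnS addSn.
Qed.

(** Minors also use exponents outside the support. The coefficient 0 there counts 2 bits, and a
    nonzero polynomial has at least 2. *)
Lemma rat_bits_mcoeff f u : f != 0 -> (rat_bits f@_u <= poly_bits f)%N.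
Proof.
move=> f0; case: (boolP (u \in msupp f)) => [uf|].
  by rewrite /poly_bits (bigD1_seq u) ?msupp_uniq //= leq_addr.
rewrite -mcoeff_eq0 => /eqP ->; apply: leq_trans (poly_bits_gt1 f0).
by rewrite /rat_bits /nat_bits trunc_log0 trunc_log1.
Qed.

Lemma mem_minors f g d : d \in minors f g ->
  exists u v, [/\ u \in msupp f, v \in msupp g & d = f@_u * g@_v - f@_v * g@_u].
Proof. by case/allpairsP => -[u v] /= [uf vg ->]; exists u, v. Qed.

Lemma size_primes_minor_le f g : f != 0 -> g != 0 ->
  (size (primes `|numq (minor f g)|) <= (poly_bits f + poly_bits g).*2.+1)%N.
Proof.
move=> f0 g0; rewrite /minor.
case E: [seq d <- minors f g | d != 0] => [|d s] //=.
have : d \in [seq d <- minors f g | d != 0] by rewrite E mem_head.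
rewrite mem_filter => /andP[d0 /mem_minors[u [v [_ _ ed]]]].
rewrite ed in d0 *; apply: leq_trans (size_primes_minor d0) _.
have := rat_bits_mcoeff u f0; have := rat_bits_mcoeff v f0.
have := rat_bits_mcoeff u g0; have := rat_bits_mcoeff v g0; lia.
Qed.

(** Let s be the size and l <= s the number of nonzero lines. The coefficients contribute at most s
    primes, and the pairs at most 4 l s + l^2 <= 5 s^2. *)
Lemma size_bad_primes pi :
  (size (bad_primes pi) <= 6 * derivation_size pi ^ 2)%N.
Proof.
set s := derivation_size pi; set l := [seq f <- pi | f != 0].
have es : (\sum_(f <- l) poly_bits f = s)%N.
  rewrite /s /derivation_size big_filter big_mkcond; apply: eq_bigr => f _.
  by case: eqP => // ->; rewrite /poly_bits msupp0 big_nil.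
have l_neq0 f : f \in l -> f != 0 by rewrite mem_filter => /andP[].
have le_l : (size l <= s)%N.
  rewrite -es -sum1_size big_seq [leqRHS]big_seq; apply: leq_sum => f fl.
  by rewrite ltnW // poly_bits_gt1 // l_neq0.
rewrite size_cat !size_flatten !sumnE !big_map -/l.
have le1 : (\sum_(f <- l) size (coef_primes f) <= s)%N.
  by rewrite -es; apply: leq_sum => f _; apply: size_coef_primes.
have le2 : (\sum_(f <- l) size (flatten [seq primes `|numq (minor f g)| | g <- l])
    <= 5 * s ^ 2)%N.
  apply: (@leq_trans (\sum_(f <- l) (2 * poly_bits f * s + 3 * s))%N).
    rewrite [leqLHS]big_seq [leqRHS]big_seq; apply: leq_sum => f fl.
    rewrite size_flatten sumnE !big_map.
    apply: (@leq_trans (\sum_(g <- l) (2 * poly_bits f + 1 + 2 * poly_bits g))%N).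
      rewrite [leqLHS]big_seq [leqRHS]big_seq; apply: leq_sum => g gl.
      have := size_primes_minor_le (l_neq0 f fl) (l_neq0 g gl); lia.
    rewrite big_split /= -big_distrr /= es big_const_seq count_predT iter_addn_0.
    apply: leq_trans (leq_add (leq_mul (leqnn _) le_l) (leqnn _)) _.
    by rewrite !mulnDl; lia.
  rewrite big_split /= -big_distrl -big_distrr /= es
    big_const_seq count_predT iter_addn_0.
  apply: leq_trans (leq_add (leqnn _) (leq_mul (leqnn _) le_l)) _.
  by rewrite -mulnn !mulnA -!mulnDl.
apply: leq_trans (leq_add le1 le2) _.
rewrite -[6%N]/(1 + 5)%N mulnDl mul1n leq_add2r.
by case: (s) => // j; rewrite -mulnn leq_pmulr.
Qed.

Lemma notin_primes (p a : nat) : prime p -> (0 < a)%N -> p \notin primes a ->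
  ~~ (p %| a)%N.
Proof. by move=> p_pr a_gt0; rewrite mem_primes p_pr a_gt0. Qed.

Lemma mem_bad_coef pi p f u : f \in pi -> u \in msupp f ->
  (p \in primes `|numq f@_u|) || (p \in primes `|denq f@_u|) ->
  p \in bad_primes pi.
Proof.
move=> fpi uf pP; rewrite mem_cat; apply/orP; left; apply/flatten_mapP.
exists f; first by rewrite mem_filter fpi andbT -msupp_eq0; case: (msupp f) uf.
by apply/flatten_mapP; exists u; rewrite // mem_cat.
Qed.

Lemma mem_bad_minor pi p f g : f \in pi -> g \in pi -> f != 0 -> g != 0 ->
  p \in primes `|numq (minor f g)| -> p \in bad_primes pi.
Proof.
move=> fpi gpi f0 g0 pP; rewrite mem_cat; apply/orP; right; apply/flatten_mapP.
exists f; first by rewrite mem_filter f0.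
by apply/flatten_mapP; exists g; rewrite // mem_filter g0.
Qed.

Variables (p : nat) (pi : seq {mpoly rat[m]}).
Hypotheses (p_pr : prime p) (p_good : p \notin bad_primes pi).

Lemma good_mcoeff f u : f \in pi -> padic_int p f@_u.
Proof.
move=> fpi; case: (boolP (u \in msupp f)) => [uf|].
  apply/padic_int_denq/notin_primes => //; first by rewrite absz_gt0 denq_eq0.
  by apply: contra p_good => pP; apply: mem_bad_coef fpi uf _; rewrite pP orbT.
by rewrite -mcoeff_eq0 => /eqP ->; apply: (padic_int_intr 0).
Qed.

(** This is why primes of numerators count as bad: the nonzero coefficients of lines become units at
    p. *)
Lemma good_mcoeff_inv f u : f \in pi -> u \in msupp f -> padic_int p (f@_u)^-1.
Proof.
move=> fpi uf; have fu0 : f@_u != 0 by rewrite -mcoeff_msupp.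
apply/padic_int_invq => //; apply/notin_primes => //.
  by rewrite absz_gt0 numq_eq0.
by apply: contra p_good => pP; apply: mem_bad_coef fpi uf _; rewrite pP.
Qed.

Lemma good_minor_inv f g : f \in pi -> g \in pi -> f != 0 -> g != 0 ->
  padic_int p (minor f g)^-1.
Proof.
move=> fpi gpi f0 g0.
have m0 : minor f g != 0.
  rewrite /minor; case E: [seq d <- minors f g | d != 0] => [|d s] //=.
  have : d \in [seq d <- minors f g | d != 0] by rewrite E mem_head.
  by rewrite mem_filter => /andP[].
apply/padic_int_invq => //; apply/notin_primes => //.
  by rewrite absz_gt0 numq_eq0.
by apply: contra p_good => pP; apply: mem_bad_minor pP.
Qed.

(** Since f_u g_v = f_v g_u is nonzero for u, v in the respective supports, the two supports
    coincide; then all ratios g_w / f_w agree. *)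
Lemma minors0_proportional f g : f != 0 ->
  all (fun d => d == 0) (minors f g) -> exists c, g = c *: f.
Proof.
move=> f0 /allP all0; case: (eqVneq g 0) => [->|g0].
  by exists 0; rewrite scale0r.
have eq0 u v : u \in msupp f -> v \in msupp g -> f@_u * g@_v = f@_v * g@_u.
  move=> uf vg; apply/eqP; rewrite -subr_eq0; apply: all0.
  exact: (allpairs_f (fun u v => f@_u * g@_v - f@_v * g@_u)).
have sub u v : u \in msupp f -> v \in msupp g -> v \in msupp f /\ u \in msupp g.
  move=> uf vg; have := eq0 _ _ uf vg; move: uf vg.
  rewrite !mcoeff_msupp => uf vg e.
  have : f@_u * g@_v != 0 by rewrite mulf_neq0.
  by rewrite e mulf_eq0 negb_or => /andP[].
have [u uf] := msupp_inhabited f0.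
have [v vg] := msupp_inhabited g0.
have [_ ug] := sub _ _ uf vg.
exists (g@_u / f@_u); apply/mpolyP => w; rewrite mcoeffZ.
have fu0 : f@_u != 0 by rewrite -mcoeff_msupp.
case: (boolP (w \in msupp g)) => [wg|wg].
  by rewrite mulrAC -[g@_u * _]mulrC -(eq0 _ _ uf wg) mulrAC mulfV // mul1r.
have wf : w \notin msupp f by apply: contra wg => wf; have [] := sub _ _ wf vg.
by move: wg wf; rewrite -!mcoeff_eq0 => /eqP -> /eqP ->; rewrite mulr0.
Qed.

Variable x : 'I_m -> rat.

(** The uncharged scalar is recovered as r_u / f_u, a quotient of coefficients of lines, hence it is
    p-integral. *)
Lemma padic_max_scale r f a : f \in pi -> r \in pi -> r = a *: f ->
  padic_max p f.@[x] -> padic_max p r.@[x].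
Proof.
move=> fpi rpi er fx; case: (eqVneq f 0) => [f0|f0].
  by move: fx; rewrite er f0 scaler0.
have [u uf] := msupp_inhabited f0.
have fu0 : f@_u != 0 by rewrite -mcoeff_msupp.
have ea : a = r@_u / f@_u by rewrite er mcoeffZ mulfK.
rewrite er mevalZ ea; apply: padic_maxMl => //.
by apply: padic_intM => //; [exact: good_mcoeff|exact: good_mcoeff_inv].
Qed.

(* The scalars [a] and [b] are not charged and may have p in their denominators.
   If [f] and [g] are independent, Cramer's rule for two monomials with a nonzero
   minor expresses them by coefficients of the lines, hence they are p-integral. *)
Lemma padic_max_lincomb r f g a b : f \in pi -> g \in pi -> r \in pi ->
  r = a *: f + b *: g ->
  padic_max p f.@[x] -> padic_max p g.@[x] -> padic_max p r.@[x].
Proof.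
move=> fpi gpi rpi er fx gx.
case: (eqVneq f 0) => [f0|f0].
  by apply: padic_max_scale gpi rpi _ gx; rewrite er f0 scaler0 add0r.
(* Proportional premises reduce the step to a rescaling of [f] alone. *)
case: (boolP (all (fun d => d == 0) (minors f g))) => [/minors0_proportional[]//|].
  move=> c eg; apply: (@padic_max_scale r f (a + b * c)) => //.
  by rewrite er eg scalerA -scalerDl.
rewrite -has_predC has_filter => hm.
have g0 : g != 0 by apply: contraNneq hm => ->; rewrite /minors msupp0 allpairs0r.
have := good_minor_inv fpi gpi f0 g0; rewrite /minor.
case E: [seq d <- minors f g | d != 0] => [|d s] /=.
  by move: hm; rewrite (eq_filter (a2 := fun d => d != 0)) // E.
have : d \in [seq d <- minors f g | d != 0] by rewrite E mem_head.
rewrite mem_filter => /andP[d0 /mem_minors[u [v [_ _ ed]]]] dinv.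
have coefP h w : h \in pi -> padic_int p h@_w by move=> hpi; apply: good_mcoeff.
have ea : a = (r@_u * g@_v - r@_v * g@_u) * d^-1.
  apply: (mulIf d0); rewrite mulfVK // er !mcoeffD !mcoeffZ ed; ring.
have eb : b = (f@_u * r@_v - f@_v * r@_u) * d^-1.
  apply: (mulIf d0); rewrite mulfVK // er !mcoeffD !mcoeffZ ed; ring.
have det h1 h2 w1 w2 h3 h4 w3 w4 :
    h1 \in pi -> h2 \in pi -> h3 \in pi -> h4 \in pi ->
    padic_int p ((h1@_w1 * h2@_w2 - h3@_w3 * h4@_w4) / d).
  by move=> ? ? ? ?; do !apply: padic_intM => //; apply: padic_intD => //;
    [|apply: padic_intN]; apply: padic_intM => //; apply: coefP.
rewrite er mevalD !mevalZ; apply: padic_maxD => //; apply: padic_maxMl => //.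
  by rewrite ea; apply: det.
by rewrite eb; apply: det.
Qed.

End BadPrimes.

(** * Evaluating a derivation modulo a good prime *)

Lemma padic_int_nat p (b : nat) : prime p -> padic_int p b%:R.
Proof. exact: (padic_int_intr (Posz b)). Qed.

Lemma binary_digits n N : (N < 2 ^ n)%N ->
  exists b : 'I_n -> bool, (\sum_(i < n) 2 ^ i * b i)%N = N.
Proof.
elim: n N => [|n IHn] N ltN.
  by exists (fun=> false); rewrite big_ord0; case: N ltN.
have [|b eb] := IHn N./2.
  by rewrite ltn_half_double -mul2n -expnS.
exists (fun i => if unlift ord0 i is Some j then b j else odd N).
rewrite big_ord_recl unlift_none mul1n -[RHS]odd_double_half -eb; congr addn.
rewrite -mul2n big_distrr; apply: eq_bigr => i _.
by rewrite liftK /= /bump expnS mulnA.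
Qed.

(** The residue of -M modulo p is below 2^n, so it has n binary digits. *)
Lemma eBVP_root_mod n (M : int) p : prime p -> (p <= 2 ^ n)%N ->
  exists b : 'I_n -> bool, (p %| M + \sum_(i < n) 2 ^+ i * (b i)%:R)%Z.
Proof.
move=> p_pr le_p; pose N := `|(- M %% p)%Z|%N.
have p0 : (p : int) != 0 by rewrite eqz_nat -lt0n prime_gt0.
have eN : (N : int) = (- M %% p)%Z by rewrite /N gez0_abs // modz_ge0.
have [|b eb] := @binary_digits n N.
  by apply: leq_trans le_p; rewrite -ltz_nat eN ltz_pmod // ltz_nat prime_gt0.
exists b.
have -> : \sum_(i < n) 2 ^+ i * (b i)%:R = N :> int.
  rewrite -eb -[RHS]natz natr_sum; apply: eq_bigr => i _.
  by rewrite natrM natrX.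
rewrite eN -[M]opprK -[in X in X + _](opprK M) addrC.
by apply/dvdz_mod0P; rewrite modzDml subrr mod0z.
Qed.

Lemma eq_meval_msupp m (f : {mpoly rat[m]}) (x y : 'I_m -> rat) :
  (forall u i, u \in msupp f -> u i != 0%N -> x i = y i) -> f.@[x] = f.@[y].
Proof.
move=> exy; rewrite !mevalE big_seq [RHS]big_seq; apply: eq_bigr => u uf.
congr (_ * _); apply: eq_bigr => i _.
by case: (eqVneq (u i) 0%N) => [->|ui0]; rewrite ?expr0 // (exy u).
Qed.

Lemma padic_int_meval p m (f : {mpoly rat[m]}) (x : 'I_m -> rat) : prime p ->
  (forall u, u \in msupp f -> padic_int p f@_u) -> (forall i, padic_int p (x i)) ->
  padic_int p f.@[x].
Proof.
move=> p_pr fp xp; rewrite mevalE big_seq.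
apply: (big_ind (padic_int p)); first exact: (padic_int_nat 0).
  by move=> ? ?; apply: padic_intD.
move=> u uf; apply: padic_intM => //; first exact: fp.
apply: (big_ind (padic_int p)); first exact: (padic_int_nat 1).
  by move=> ? ?; apply: padic_intM.
by move=> i _; apply: padic_intX.
Qed.

(* An extension axiom that is not p-integral cannot be a line when p is good, so
   its variable may take any value; the proof chooses 0. *)
Lemma extension_assignment p n k (q : 'I_k -> extpoly n k) (x : 'I_n -> rat) :
  prime p -> extension_system q -> (forall i, padic_int p (x i)) ->
  exists y : 'I_(n + k) -> rat,
    [/\ forall i, y (lshift k i) = x i, forall i, padic_int p (y i) &
        forall j, (forall u, padic_int p (q j)@_u) ->
          y (rshift n j) = (q j).@[y]].
Proof.
move=> p_pr qP xp.
suff ex t : (t <= k)%N -> exists y : 'I_(n + k) -> rat,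
    [/\ forall i, y (lshift k i) = x i, forall i, padic_int p (y i) &
        forall j : 'I_k, (j < t)%N -> (forall u, padic_int p (q j)@_u) ->
          y (rshift n j) = (q j).@[y]].
  by have [y [yl yp yr]] := ex k (leqnn k); exists y; split=> // j; apply: yr.
elim: t => [|t IHt] le_tk.
  exists (fun i => if split i is inl i' then x i' else 0); split=> // i.
    by rewrite (unsplitK (inl _ i)).
  by case: (split i) => [i'|_]; [exact: xp|exact: (padic_int_nat 0)].
have [y [yl yp yr]] := IHt (ltnW le_tk); pose t' := Ordinal le_tk.
have [z zp zE] : exists2 z, padic_int p z &
    (forall u, padic_int p (q t')@_u) -> z = (q t').@[y].
  have [qp|nqp] := pselect (forall u, padic_int p (q t')@_u).
    by exists (q t').@[y] => //; apply: padic_int_meval.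
  by exists 0 => //; exact: (padic_int_nat 0).
pose y' i := if i == rshift n t' then z else y i.
(* Resetting the variable with index n + t changes no [q j] with j <= t, because these mention only
   variables of smaller index. *)
have y'E (j : 'I_k) : (j <= t)%N -> (q j).@[y'] = (q j).@[y].
  move=> le_jt; apply: eq_meval_msupp => u i uq ui; rewrite /y'.
  case: eqP => // ei; case/negP: ui; apply/eqP/(qP j) => //; rewrite ei /=.
  by rewrite leq_add2l.
exists y'; split=> [i|i|j].
- by rewrite /y' -yl; case: eqP => // /eqP; rewrite eq_lrshift.
- by rewrite /y'; case: eqP.
rewrite ltnS => le_jt qp; rewrite y'E // /y'.
case: eqP => [/rshift_inj ej|nej]; first by rewrite ej in qp *; apply: zE.
apply: yr => //; rewrite ltn_neqAle le_jt andbT.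
by apply: contra_notN nej => /eqP ejt; congr rshift; apply: val_inj.
Qed.

(** Strong induction along the lines, with one case for each inference rule. *)
Lemma derivation_padic_max p n k Gamma (q : 'I_k -> extpoly n k) pi
    (y : 'I_(n + k) -> rat) :
  prime p -> p \notin bad_primes pi -> derivation Gamma q pi ->
  (forall i, padic_int p (y i)) ->
  (forall r, Gamma r -> padic_max p r.@[y]) ->
  (forall j, (forall u, padic_int p (q j)@_u) -> y (rshift n j) = (q j).@[y]) ->
  forall r, r \in pi -> padic_max p r.@[y].
Proof.
move=> p_pr p_good [_ piP] yp Gp yq r /(nthP 0)[i lti <-{r}].
elim/ltn_ind: i lti => i IHi lti.
have prevP f : f \in take i pi -> f \in pi /\ padic_max p f.@[y].
  move=> fi; split; first exact: mem_take fi.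
  move: fi => /(nthP 0)[j]; rewrite size_take lti => ltji <-.
  rewrite nth_take //; apply: IHi => //; exact: ltn_trans lti.
have := piP i lti; have := mem_nth 0 lti; move: pi`_i => r rpi.
case=> [[/Gp //|[j er]]|[a [b [f [g [/prevP[fpi fy] /prevP[gpi gy] er]]]]]
       |[j [f [/prevP[_ fy] ->]]]|/prevP[_]].
(* Since the axiom is itself a line, its coefficients are p-integral, and so are those of [q j]. The
   assignment then satisfies it exactly. *)
- rewrite er mevalB mevalXU yq ?subrr; first exact: (padic_max_intr (a := 0)).
  move=> u; have -> : (q j)@_u = 'X_(rshift n j)@_u - r@_u.
    by rewrite er mcoeffB subKr.
  apply: padic_intD => //; first by rewrite mcoeffX; apply: padic_int_nat.
  by apply: padic_intN; apply: good_mcoeff rpi.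
- exact: (padic_max_lincomb p_pr p_good fpi gpi rpi er fy gy).
- by rewrite mevalM mevalXU; apply: padic_maxMl.
(* The conclusion [r] is also a line, so its value is p-integral and primality of the ideal applies
   to its square. *)
rewrite rmorphXn /= expr2 => ry.
have rp : padic_int p r.@[y].
  by apply: padic_int_meval => // u _; apply: good_mcoeff rpi.
by have [] := padic_maxM p_pr rp rp ry.
Qed.

(** A variable is read as true when its value is 1 modulo the ideal. Each clause product lies in the
    ideal, hence so does one factor, and the literal of that factor is true. *)
Lemma good_prime_cnf_sat p n k M (q : 'I_k -> extpoly n k) pi (F : cnf (n + k)) :
  prime p -> (p <= 2 ^ n)%N -> p \notin bad_primes pi ->
  derivation (@eBVP n k M) q pi -> derives_cnf q pi F ->
  exists v, cnf_sat v F.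
Proof.
move=> p_pr le_p p_good piP [[neg negvarP clauseP] occP].
have [b bP] := eBVP_root_mod M p_pr le_p.
have [y [yl yp yr]] := @extension_assignment p n k q (fun i => (b i)%:R) p_pr piP.1
  (fun i => padic_int_nat _ p_pr).
have y_max r : r \in pi -> padic_max p r.@[y].
  apply: derivation_padic_max piP _ _ _ _ => // {}r [->|[i ->]].
    have -> : (eBVP_eq n k M).@[y] = (M + \sum_(i < n) 2 ^+ i * (b i)%:R)%:~R.
      rewrite mevalD rmorph_int rmorphD raddf_sum rmorph_sum /=; congr (_ + _).
      apply: eq_bigr => i _.
      by rewrite mevalZ mevalXU yl rmorphM rmorphXn /= !rmorph_nat.
    exact: padic_max_intr.
  rewrite mevalB rmorphXn /= mevalXU yl expr2.
  by case: (b i); rewrite ?mulr1 ?mul0r subrr; apply: (padic_max_intr (a := 0)).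
pose v i := `[< padic_max p (y i - 1) >].
have y01 i : occurs i F -> padic_max p (y i) \/ padic_max p (y i - 1).
  move=> /occP/y_max; rewrite mevalB rmorphXn /= mevalXU => yi.
  apply: padic_maxM => //; last by rewrite mulrBr mulr1 -expr2.
  by apply: padic_intD => //; apply: (padic_int_intr (-1)).
exists v; apply/allP => C CF; have := y_max _ (clauseP C CF).
have occ l : l \in C -> occurs l.1 F.
  by case: l => i c lC; exists C => //; exists c.
have : {in C, forall l, l \in C /\ occurs l.1 F}.
  by move=> l lC; split=> //; apply: occ.
rewrite /clause_poly rmorph_prod /=.
(* The induction runs over lists of literals of [C] while [C] stays fixed. The empty product is 1,
   which is not in the ideal. *)
elim: {-2 3}C => [_|l D IHD DC]; first by rewrite big_nil => /(padic_max1 p_pr).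
have [lC lF] := DC l (mem_head _ _).
rewrite big_cons => /(padic_maxM p_pr) [||ly|Dy].
- by rewrite mevalXU.
- apply: (big_ind (padic_int p)); first exact: (padic_int_nat 1).
    by move=> ? ?; apply: padic_intM.
  by move=> i _; rewrite mevalXU.
(* For a positive literal the factor is the negation variable. Its definition has integer
   coefficients, so its value is exactly 1 - [y i]. *)
- apply/orP; left; move: ly lC lF; case: l {DC} => i [] /=; rewrite mevalXU /v.
    move=> yn lC _; have [j enj qj] := negvarP _ _ CF lC; apply/eqP/asboolP.
    move: yn; rewrite enj yr qj.
      rewrite mevalB meval1 mevalXU.
      move=> /(padic_maxMl p_pr (padic_int_intr (-1) p_pr)).
      by rewrite mulN1r opprB.
    move=> u; rewrite mcoeffB mcoeff1 mcoeffX; apply: padic_intD => //.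
      exact: padic_int_nat.
    by apply: padic_intN; apply: padic_int_nat.
  (* For a negative literal, [y i] and [y i - 1] cannot both lie in the ideal, since their
     difference is 1. *)
  move=> yi _ _; rewrite eqbF_neg; apply/asboolPn => yi1.
  apply: (padic_max1 p_pr); rewrite -(subKr (y i) 1).
  apply: padic_maxD => //; rewrite -mulN1r.
  exact: padic_maxMl (padic_int_intr (-1) p_pr) yi1.
by apply/orP; right; apply: IHD => // l' l'D; apply: DC; rewrite inE l'D orbT.
Qed.

(** * The lower bound on the size *)

Lemma exp2_le_derivation_size n k M (q : 'I_k -> extpoly n k) pi (F : cnf (n + k)) :
  (0 < n)%N -> derivation (@eBVP n k M) q pi -> unsatisfiable F ->
  derives_cnf q pi F -> (2 ^ n <= 12 * n * derivation_size pi ^ 2)%N.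
Proof.
move=> n_gt0 piP unsatF FP.
have sub : {subset primes_upto (2 ^ n) <= bad_primes pi}.
  move=> p; rewrite mem_primes_upto => /andP[p_pr le_p].
  apply: contraT => p_good.
  have [v vF] := good_prime_cnf_sat p_pr le_p p_good piP FP.
  by have := unsatF v; rewrite vF.
have := uniq_leq_size (primes_upto_uniq _) sub.
move=> /leq_trans/(_ (size_bad_primes pi)) le_size.
(* The constant 12 is 2 from 2^n = 2 * 2^(n-1) times 6 from [size_bad_primes]. *)
rewrite -[X in (2 ^ X)%N](prednK n_gt0) expnS.
apply: leq_trans (leq_mul (leqnn 2) (primes_upto_exp2 n_gt0)) _.
rewrite [leqRHS](_ : _ = 2 * (n * (6 * derivation_size pi ^ 2)))%N; last by ring.
by rewrite !leq_mul.
Qed.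

(** The base case is 1000 <= 1024, and (n+1)^3 <= 2 n^3 from there on. *)
Lemma leq_cube_exp2 n : (10 <= n)%N -> (n ^ 3 <= 2 ^ n)%N.
Proof.
elim: n => // n IHn; rewrite leq_eqVlt => /orP[/eqP <- //|].
rewrite ltnS => le_n; have := IHn le_n; rewrite [(2 ^ _.+1)%N]expnS !expnS expn0.
nia.
Qed.

Theorem theorem6 (R : realType) :
  exists2 c : R, 0 < c & exists n0 : nat,
  forall (n k : nat) (M : int) (q : 'I_k -> extpoly n k)
         (pi : seq (extpoly n k)) (F : cnf (n + k)),
    (n0 <= n)%N -> 0 < M ->
    derivation (@eBVP n k M) q pi ->
    unsatisfiable F -> derives_cnf q pi F ->
    c * 2 `^ (n%:R / 3) <= (derivation_size pi)%:R.
Proof.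
(* With X = 2^(n/3) and n <= X, the bound X^3 <= 12 n s^2 gives X^2 <= 12 s^2 <= 16 s^2, hence the
   factor 1/4. The threshold 10 comes from [leq_cube_exp2]. *)
exists 4^-1; first by rewrite invr_gt0.
exists 10%N => n k M q pi F le_n _ piP unsatF FP.
have n_gt0 : (0 < n)%N by apply: leq_trans le_n.
have le_s := exp2_le_derivation_size n_gt0 piP unsatF FP.
set s := derivation_size pi in le_s *; set X := 2 `^ _.
have X_gt0 : 0 < X by rewrite powR_gt0.
have X3 : X ^+ 3 = 2 ^+ n.
  by rewrite /X -powR_mulrn ?powR_ge0 // -powRrM divfK ?pnatr_eq0 // powR_mulrn.
have le_nX : n%:R <= X.
  rewrite -(ler_pXn2r (n := 3)) ?nnegrE ?(ltW X_gt0) ?ler0n // X3.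
  rewrite -natrX -natrX ler_nat.
  exact: leq_cube_exp2.
have {}le_s : X ^+ 3 <= 12 * n%:R * s%:R ^+ 2.
  by rewrite X3 -!natrX -!natrM ler_nat.
rewrite -(ler_pXn2r (n := 2)) ?nnegrE ?ler0n ?mulr_ge0 ?invr_ge0
  ?ler0n ?(ltW X_gt0) //.
(* One factor n is replaced by X so that X can be cancelled. *)
have : X ^+ 2 * X <= 12 * s%:R ^+ 2 * X.
  rewrite -exprSr (le_trans le_s) // mulrAC ler_wpM2l // mulr_ge0 // exprn_ge0 //.
rewrite ler_pM2r // exprMn => leX.
have := sqr_ge0 X; have := sqr_ge0 (s%:R : R); lra.
Qed.
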